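(* Let $M\ge0$. Let $c_0$ be the linear functional associated to the measure $e^{-x}dx+M\delta(0)$ and $c_1$ the one associated to $e^{-x}dx$, on $]0,+\infty[$. Let $P_n(x,M)$ be the monic polynomials orthogonal with respect to $c_0$. Then $$P_n(x,M)=L_n(x)+\sum_{j=0}^{n-1}(-1)^{n+1+j}\frac{n!\,M}{j!\,(nM+1)}L_j(x),\quad n\ge 0,$$ the square norm $k_n^{(0)}=c_0(P_n(x,M)^2)$ is $$k_n^{(0)}=(n!)^2\,\frac{(n+1)M+1}{nM+1},\quad n\ge0,$$ and the coefficient $\sigma_n$ of the coherence relation is $$\sigma_n=-\frac{n(1+nM)}{(n+1)M+1},\quad n\ge1.$$
   Context: $\delta(0)$ is the Dirac measure at $0$, so $c_0(p)=\int_0^\infty p(x)e^{-x}dx+Mp(0)$. $L_n$ denotes the monic classical Laguerre polynomial of degree $n$, orthogonal with respect to $e^{-x}dx$ on $]0,+\infty[$. The pair $(c_0,c_1)$ is coherent: $\sigma_n$ ($n\ge1$) is the real number such that $T_n(x)=\frac{P_{n+1}'(x,M)}{n+1}-\sigma_n\frac{P_n'(x,M)}{n}$, where $T_n=L_n$ is the monic orthogonal polynomial with respect to $c_1$ and $'$ is the derivative in $x$. *)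

(* Defs.v *)
From HB Require Import structures.
From mathcomp Require Import all_boot all_order all_algebra.
From mathcomp Require Import all_classical all_reals all_analysis.

Set Implicit Arguments.
Unset Strict Implicit.
Unset Printing Implicit Defensive.

Import Order.TTheory GRing.Theory Num.Theory.
Import numFieldNormedType.Exports.

Local Open Scope classical_set_scope.
Local Open Scope ring_scope.

Definition laguerre_functional {R : realType} (p : {poly R}) : R :=
  (\int[lebesgue_measure]_(x in `]0, +oo[) (p.[x] * expR (- x)))%R.

(* The whole mass M of the Dirac measure is counted, although the endpoint 0
   does not belong to the open interval ]0, +oo[. *)
Definition laguerre_dirac_functional {R : realType} (M : R) (p : {poly R}) : R :=
  laguerre_functional p + M * p.[0].

Definition monic_orthogonal {R : realType} (c : {poly R} -> R)
    (P : nat -> {poly R}) : Prop :=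
  [/\ forall n, size (P n) = n.+1,
      forall n, P n \is monic
    & forall m n, m != n -> c (P m * P n) = 0].

(* The value s is the coefficient sigma_n of
   T_n = P_(n+1)' / (n+1) - sigma_n P_n' / n, which is meant for 0 < n only. *)
Definition coherence_coefficient {R : realType} (P T : nat -> {poly R})
    (n : nat) (s : R) : Prop :=
  T n = n.+1%:R^-1 *: (P n.+1)^`() - s *: (n%:R^-1 *: (P n)^`()).

(* Main.v *)
(* Integration by parts gives [c1 (p - p') = p(0)], so the Rodrigues formula
   [L_n = (1 - D)^n X^n] yields [c1 (L_n q) = c1 (X^n q^(n))], hence orthogonality
   and the norm [n!^2], while [L_(n+1)' = (n+1) (L_n - L_n')] is immediate.
   For [deg q < n], [c1 (L_n' q) = - L_n(0) q(0)]: a multiple of [L_n'] therefore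
   compensates the mass at 0, and [P_n = L_n + M / (nM + 1) L_n'].  The expansion
   of [P_n], its norm and [sigma_n] are all read off from this closed form. *)

Require Import Defs.
From HB Require Import structures.
From mathcomp Require Import all_boot all_order all_algebra.
From mathcomp Require Import all_classical all_reals all_analysis.
From mathcomp Require Import measurable_realfun ring.

Set Implicit Arguments.
Unset Strict Implicit.
Unset Printing Implicit Defensive.

Import Order.TTheory GRing.Theory Num.Theory.
Import numFieldNormedType.Exports.

Local Open Scope classical_set_scope.
Local Open Scope ring_scope.

(** * Monic orthogonal sequences and Laguerre polynomials *)

Lemma size_sub_monic (R : nzRingType) (n : nat) (p q : {poly R}) :
  size q = n.+1 -> q \is monic -> (size p <= n.+1)%N ->
  (size (p - p`_n *: q)%R <= n)%N.
Proof.
move=> sq /monicP; rewrite lead_coefE sq/= => q1 sp.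
apply/leq_sizeP => j; rewrite leq_eqVlt => /predU1P[<-|nj].
  by rewrite coefB coefZ q1 mulr1 subrr.
have pj : (size p <= j)%N by apply: leq_trans nj.
by rewrite coefB coefZ (nth_default _ pj) [q`_j]nth_default ?sq// mulr0 subr0.
Qed.

(** Induction on the degree: subtracting a multiple of [P k] with k < n lowers the degree of q, and
    [P n] is orthogonal to [P k]. *)
Lemma monic_orthogonal_lower (R : realType) (c : {scalar {poly R}})
    (P : nat -> {poly R}) (n : nat) (q : {poly R}) :
  monic_orthogonal c P -> (size q <= n)%N -> c (P n * q) = 0.
Proof.
move=> [sP mP oP].
suff H (k : nat) (r : {poly R}) : (k <= n)%N -> (size r <= k)%N ->
  c (P n * r) = 0 by exact: H.
elim: k r => [|k IH] {}q kn sq.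
  by move: sq; rewrite leqn0 size_poly_eq0 => /eqP ->; rewrite mulr0 linear0.
rewrite -(subrK (q`_k *: P k) q) mulrDr linearD/= IH ?(ltnW kn)//; last first.
  exact: size_sub_monic.
by rewrite add0r -scalerAr linearZ/= oP ?mulr0// gtn_eqF.
Qed.

Lemma monic_orthogonal_of_lower (R : realType) (c : {poly R} -> R)
    (P : nat -> {poly R}) :
  (forall n, size (P n) = n.+1) -> (forall n, P n \is monic) ->
  (forall n (q : {poly R}), (size q <= n)%N -> c (P n * q) = 0) ->
  monic_orthogonal c P.
Proof.
move=> sP mP oP; split=> // m n; rewrite neq_ltn => /orP[mn|nm].
  by rewrite mulrC oP ?sP.
by rewrite oP ?sP.
Qed.

(** The difference d has degree m < n and is orthogonal to all degrees below n. Pairing it with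
    [Q m] leaves its leading coefficient times c(Q_m^2), so d = 0. This lets explicit sequences
    replace the given [L] and [P]. *)
Lemma monic_orthogonal_uniq (R : realType) (c : {scalar {poly R}})
    (P Q : nat -> {poly R}) (n : nat) :
  monic_orthogonal c P -> monic_orthogonal c Q ->
  (forall k, c (Q k ^+ 2) != 0) -> P n = Q n.
Proof.
move=> oP oQ Q0; have [sP mP _] := oP; have [sQ mQ _] := oQ.
have sd : (size (P n - Q n)%R <= n)%N.
  have := size_sub_monic (sQ n) (mQ n) (eq_leq (sP n)).
  by have /monicP := mP n; rewrite lead_coefE sP => ->; rewrite scale1r.
have d_orth (q : {poly R}) : (size q <= n)%N -> c ((P n - Q n) * q) = 0.
  by move=> sq; rewrite mulrBl linearB/= !monic_orthogonal_lower// subrr.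
apply/eqP; rewrite -subr_eq0; set d := P n - Q n in sd d_orth *.
apply/negPn/negP => d0; have [m sm] : exists m, size d = m.+1.
  by exists (size d).-1; rewrite prednK// lt0n size_poly_eq0.
have := d_orth (Q m); rewrite sQ -sm => /(_ sd).
rewrite -{1}(subrK (d`_m *: Q m) d) mulrDl linearD/=.
rewrite mulrC monic_orthogonal_lower ?add0r//; last first.
  by apply: size_sub_monic => //; rewrite sm.
rewrite -scalerAl linearZ/= -expr2 => /eqP; rewrite mulf_eq0 (negbTE (Q0 m)) orbF.
by move: d0; rewrite -lead_coef_eq0 lead_coefE sm => /negbTE ->.
Qed.

(** As e^x (e^(-x) p)' = p' - p, this is (-1)^n e^x (e^(-x) x^n)^(n), the sign making it monic. *)
Definition laguerre (R : nzRingType) (n : nat) : {poly R} :=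
  iter n (fun p => p - p^`()) 'X^n.

Lemma size_iter_subr_deriv (R : nzRingType) (k : nat) (p : {poly R}) :
  size (iter k (fun q => q - q^`()) p) = size p.
Proof.
elim: k => //= k <-; set q := iter _ _ _.
have [->|q0] := eqVneq q 0; first by rewrite deriv0 subr0.
by rewrite size_polyDl// size_polyN lt_size_deriv.
Qed.

Lemma lead_coef_iter_subr_deriv (R : nzRingType) (k : nat) (p : {poly R}) :
  lead_coef (iter k (fun q => q - q^`()) p) = lead_coef p.
Proof.
elim: k => //= k <-; set q := iter _ _ _.
have [->|q0] := eqVneq q 0; first by rewrite deriv0 subr0.
by rewrite lead_coefDl// size_polyN lt_size_deriv.
Qed.

Lemma size_laguerre (R : nzRingType) (n : nat) : size (laguerre R n) = n.+1.
Proof. by rewrite size_iter_subr_deriv size_polyXn. Qed.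

Lemma laguerre_monic (R : nzRingType) (n : nat) : laguerre R n \is monic.
Proof. by rewrite monicE lead_coef_iter_subr_deriv lead_coefXn. Qed.

Lemma size_deriv_laguerre (R : nzRingType) (n : nat) :
  (size (laguerre R n)^`() <= n)%N.
Proof.
rewrite -ltnS -(size_laguerre R n).
by rewrite lt_size_deriv// monic_neq0// laguerre_monic.
Qed.

Lemma deriv_iter_subr_deriv (R : nzRingType) (k : nat) (p : {poly R}) :
  (iter k (fun q => q - q^`()) p)^`() = iter k (fun q => q - q^`()) p^`().
Proof. by elim: k => //= k IH; rewrite derivB IH. Qed.

Lemma iter_subr_derivMn (R : nzRingType) (k m : nat) (p : {poly R}) :
  iter k (fun q => q - q^`()) (p *+ m) = iter k (fun q => q - q^`()) p *+ m.
Proof. by elim: k => //= k ->; rewrite derivMn mulrnBl. Qed.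

Lemma deriv_laguerreS (R : nzRingType) (n : nat) :
  (laguerre R n.+1)^`() = (laguerre R n - (laguerre R n)^`()) *+ n.+1.
Proof. by rewrite /laguerre deriv_iter_subr_deriv derivXn iter_subr_derivMn. Qed.

(** Each 1 - D lowers the multiplicity of the root 0 by at most one; this makes the boundary terms
    at 0 vanish in repeated integration by parts. *)
Lemma iter_subr_deriv_Xn (R : comNzRingType) (k m : nat) :
  exists r : {poly R}, iter k (fun q => q - q^`()) 'X^(m + k) = r * 'X^m.
Proof.
elim: k m => [|k IH] m; first by exists 1; rewrite addn0 mul1r.
rewrite addnS -addSn; have [r /= ->] := IH m.+1.
(* Read off from (1 - D)(r X^(m+1)) = (r X - r' X - (m+1) r) X^m. *)
exists (r * 'X - r^`() * 'X - r *+ m.+1).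
by rewrite derivM derivXn !exprS/= -mulr_natr -(mulr_natr r); ring.
Qed.

Lemma iter_subr_deriv_Xn0 (R : comNzRingType) (k n : nat) : (k < n)%N ->
  (iter k (fun q => q - q^`()) 'X^n : {poly R}).[0] = 0.
Proof.
move=> kn; have [r] := @iter_subr_deriv_Xn R k (n - k).
by rewrite subnK 1?ltnW// => ->; rewrite hornerM hornerXn expr0n subn_eq0 leqNgt kn mulr0.
Qed.

(** Unrolls L_(n+1)' = (n+1)(L_n - L_n'): each step multiplies the old coefficients by -(n+1) and
    adds the term (n+1) L_n. *)
Lemma sum_deriv_laguerre (R : numFieldType) (n : nat) :
  (laguerre R n)^`() =
    \sum_(j < n) ((-1) ^+ (n + 1 + j) * (n`!%:R / j`!%:R)) *: laguerre R j.
Proof.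
elim: n => [|n IH]; first by rewrite big_ord0 /laguerre/= expr0 derivC.
rewrite deriv_laguerreS big_ord_recr/= IH mulrnBl addrC; congr (_ + _).
  rewrite -scaler_nat; congr (_ *: _).
  rewrite addn1 factS natrM mulfK ?pnatr_eq0 -?lt0n ?fact_gt0//.
  by rewrite addSn exprS -signr_odd addSn addnn/= odd_double expr1 mulrNN !mul1r.
rewrite -mulNrn -sumrN -sumrMnl; apply: eq_bigr => j _.
rewrite -scaler_nat -scaleNr scalerA; congr (_ *: _).
by rewrite factS natrM !addSn exprS; ring.
Qed.

(** * Laguerre polynomials under a functional with c(p - p') = p(0) *)

Section LaguerreFunctional.
Variables (R : numFieldType) (c : {scalar {poly R}}).
(* On a weight [w] with [w' = - w] this is integration by parts. *)
Hypothesis c_subr_deriv : forall p, c (p - p^`()) = p.[0].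

Lemma functional_deriv (p : {poly R}) : c p^`() = c p - p.[0].
Proof. by rewrite -c_subr_deriv linearB/= opprB addrC subrK. Qed.

Lemma functional_Xn (n : nat) : c 'X^n = n`!%:R.
Proof.
elim: n => [|n IH].
  by have := c_subr_deriv 1; rewrite derivC subr0 hornerC.
have := c_subr_deriv 'X^(n.+1).
rewrite derivXn linearB linearMn/= IH hornerXn expr0n/= => /subr0_eq ->.
by rewrite factS natrM mulr_natl.
Qed.

(** Since (p - p') q = (1 - D)(p q) + p q', each 1 - D on the left becomes a D on q, at the cost of
    p(0) q(0); here p(0) = 0 because fewer than n factors 1 - D have acted on X^n. *)
Lemma functional_iter_subr_deriv (k n : nat) (q : {poly R}) : (k <= n)%N ->
  c (iter k (fun p => p - p^`()) 'X^n * q) = c ('X^n * q^`(k)).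
Proof.
elim: k q => [|k IH] q kn; first by rewrite derivn0.
rewrite derivSn -IH 1?ltnW//= mulrBl.
set p := iter _ _ _.
have -> : p * q - p^`() * q = (p * q - (p * q)^`()) + p * q^`().
  by rewrite derivM; ring.
by rewrite linearD/= c_subr_deriv hornerM iter_subr_deriv_Xn0// mul0r add0r.
Qed.

Lemma laguerre_orthogonal (n : nat) (q : {poly R}) : (size q <= n)%N ->
  c (laguerre R n * q) = 0.
Proof.
by move=> qn; rewrite functional_iter_subr_deriv// derivn_poly0// mulr0 linear0.
Qed.

(** One factor L_n may be replaced by X^n, up to lower degree; the n-th derivative of X^n is n!, and
    c(X^n) = n!. *)
Lemma laguerre_norm (n : nat) : c (laguerre R n ^+ 2) = n`!%:R ^+ 2.
Proof.
have sz := size_sub_monic (size_laguerre R n) (laguerre_monic R n).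
have /sz : (size ('X^n : {poly R}) <= n.+1)%N by rewrite size_polyXn.
rewrite coefXn eqxx scale1r => /laguerre_orthogonal.
rewrite mulrBr linearB/= => /subr0_eq <-.
rewrite functional_iter_subr_deriv// derivnXn subnn expr0 ffactnn.
by rewrite mulr_natr linearMn/= functional_Xn -(mulr_natr n`!%:R) expr2.
Qed.

(** As c(L_(n+1)) = 0, the value L_(n+1)(0) is -c(L_(n+1)') = -(n+1) c(L_n - L_n') = -(n+1)
    L_n(0). *)
Lemma laguerre_at0 (n : nat) : (laguerre R n).[0] = (-1) ^+ n * n`!%:R.
Proof.
elim: n => [|n IH]; first by rewrite /laguerre/= expr0 hornerC mulr1.
have := functional_deriv (laguerre R n.+1).
rewrite deriv_laguerreS linearMn/= c_subr_deriv IH.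
rewrite -[laguerre R n.+1]mulr1 laguerre_orthogonal ?size_poly1//.
rewrite mulr1 sub0r => /(congr1 -%R); rewrite opprK => <-.
by rewrite factS natrM exprS -mulr_natr; ring.
Qed.

Lemma deriv_laguerre_at0 (n : nat) :
  (laguerre R n)^`().[0] = - (n%:R * (laguerre R n).[0]).
Proof.
elim: n => [|n IH]; first by rewrite /laguerre/= derivC hornerC mul0r oppr0.
rewrite deriv_laguerreS hornerMn hornerD hornerN IH !laguerre_at0.
by rewrite factS natrM exprS -mulr_natr -natr1; ring.
Qed.

(** In c((L_n q)') = c(L_n q) - L_n(0) q(0), orthogonality kills both L_n q and L_n q'. Thus L_n'
    is, up to a factor, the reproducing kernel at 0 in degree < n. *)
Lemma deriv_laguerre_reproducing (n : nat) (q : {poly R}) : (size q <= n)%N ->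
  c ((laguerre R n)^`() * q) = - ((laguerre R n).[0] * q.[0]).
Proof.
move=> qn; have := functional_deriv (laguerre R n * q).
rewrite derivM linearD/= hornerM !laguerre_orthogonal ?sub0r ?addr0//.
have [->|q0] := eqVneq q 0; first by rewrite deriv0 size_poly0.
by rewrite (leq_trans _ qn)// ltnW// lt_size_deriv.
Qed.

End LaguerreFunctional.

(** * The weight exp(-x) on the half-line *)

Lemma poly_ind_Xn (R : nzRingType) (K : {poly R} -> Prop) :
  (forall n, K 'X^n) -> (forall p q, K p -> K q -> K (p + q)) ->
  (forall a p, K p -> K (a *: p)) -> forall p, K p.
Proof.
move=> KX KD KZ p; rewrite -(coefK p) poly_def.
apply: big_ind => [|//|i _]; last exact/KZ/KX.
by rewrite -(scale0r 1) -(expr0 'X); exact/KZ/KX.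
Qed.

Lemma horner_expRN_cvg0 (R : realType) (p : {poly R}) :
  p.[x] * expR (- x) @[x --> +oo] --> (0 : R).
Proof.
have Xn_cvg (k : nat) : x ^+ k * expR (- x) @[x --> +oo] --> (0 : R).
  apply/cvgrPdist_le => e e0; near=> x.
  have x0 : 0 < x by near: x; apply: nbhs_pinfty_gt; exact: num_real.
  rewrite sub0r normrN ger0_norm; last by rewrite mulr_ge0 ?expR_ge0 ?exprn_ge0// ltW.
  rewrite expRN ler_pdivrMr ?expR_gt0//.
  have f0 : 0 < k.+1`!%:R :> R by rewrite ltr0n fact_gt0.
  (* The exponent k+1 leaves a spare factor x, which eventually exceeds (k+1)!/e. *)
  have xk : x ^+ k.+1 / k.+1`!%:R <= expR x.
    by rewrite (le_trans _ (expR_ge1Dxn k (ltW x0)))// lerDr.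
  rewrite (le_trans _ (ler_wpM2l (ltW e0) xk))//.
  have -> : e * (x ^+ k.+1 / k.+1`!%:R) = x ^+ k * (e * x / k.+1`!%:R).
    by rewrite exprS; ring.
  by rewrite ler_peMr ?exprn_ge0 ?(ltW x0)// ler_pdivlMr// mul1r mulrC -ler_pdivrMr//.
elim/poly_ind_Xn: p => [n|p q IHp IHq|a p IH].
- by under eq_fun do rewrite hornerXn; exact: Xn_cvg.
- under eq_fun do rewrite hornerD mulrDl.
  by rewrite -(addr0 0); exact: cvgD.
- under eq_fun do rewrite hornerZ -mulrA.
  by rewrite -(mulr0 a); exact: cvgMr.
Unshelve. all: end_near. Qed.

Lemma continuous_horner_expRN (R : realType) (p : {poly R}) :
  continuous (fun x => p.[x] * expR (- x)).
Proof.
move=> x; apply: cvgM; first exact: continuous_horner.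
by apply: continuous_comp; [exact: oppr_continuous|exact: continuous_expR].
Qed.

Lemma measurable_horner_expRN (R : realType) (p : {poly R}) (D : set R) :
  measurable_fun D (fun x => (p.[x] * expR (- x))%:E).
Proof.
apply/measurable_EFinP; apply: measurable_funTS.
by apply: continuous_measurable_fun; exact: continuous_horner_expRN.
Qed.

Lemma integral_Xn_expRN (R : realType) (n : nat) :
  (\int[lebesgue_measure]_(x in `]0%R, +oo[) (('X^n).[x] * expR (- x))%:E
    = (n`!%:R : R)%:E)%E.
Proof.
(* A primitive of x^n e^(-x) is -G e^(-x) when G - G' = X^n; such G obey G_(n+1) = X^(n+1) + (n+1)
   G_n. *)
have [G GE G0] : exists2 G : {poly R}, G - G^`() = 'X^n & G.[0] = n`!%:R.
  elim: n => [|n [G GE G0]]; first by exists 1; rewrite ?derivC ?subr0// hornerC.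
  exists ('X^(n.+1) + G *+ n.+1); last first.
    by rewrite hornerD hornerMn hornerXn expr0n/= add0r G0 factS natrM mulr_natl.
  by rewrite derivD derivMn derivXn -GE/= mulrnBl; ring.
have fE x : - (G^`().[x] * expR (- x) - G.[x] * expR (- x)) =
    ('X^n).[x] * expR (- x) :> R.
  by rewrite -GE hornerD hornerN; ring.
have dF (x : R) : is_derive x 1 (fun x => - (G.[x] * expR (- x)))
    (('X^n).[x] * expR (- x)).
  rewrite -fE; apply: is_deriveN.
  have dexp : is_derive x 1 (expR \o -%R) (expR (- x) * -1).
    by apply: is_derive1_comp; exact: is_deriveN.
  apply: is_derive_eq (is_deriveM (is_derive_poly G x) dexp) _.
  by rewrite /GRing.scale/=; ring.
rewrite integral_itv_obnd_cbnd; last exact: measurable_horner_expRN.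
rewrite (@ge0_continuous_FTC2y R _ (fun x => - (G.[x] * expR (- x))) _ 0).
- by rewrite oppr0 expR0 mulr1 G0 sub0e -EFinN opprK.
- by move=> x x0; rewrite mulr_ge0 ?expR_ge0// hornerXn exprn_ge0.
- exact/continuous_subspaceT/continuous_horner_expRN.
- by rewrite -(oppr0); apply: cvgN; exact: horner_expRN_cvg0.
- by move=> x _; have [] := dF x.
- by apply: cvg_at_right_filter; apply: cvgN; exact: continuous_horner_expRN.
- by move=> x _; rewrite derive1E; have [] := dF x.
Qed.

(** Monomials are nonnegative on the half-line, so the integral of the absolute value is the known
    n!; linearity does the rest. *)
Lemma integrable_horner_expRN (R : realType) (p : {poly R}) :
  lebesgue_measure.-integrable `]0, +oo[ (fun x => (p.[x] * expR (- x))%:E).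
Proof.
elim/poly_ind_Xn: p => [n|p q IHp IHq|a p IH].
- apply/integrableP; split; first exact: measurable_horner_expRN.
  rewrite (_ : integral _ _ _ = n`!%:R%:E) ?ltry// -integral_Xn_expRN.
  apply: eq_integral => x; rewrite inE/= in_itv/= andbT => x0.
  by rewrite ger0_norm// mulr_ge0 ?expR_ge0// hornerXn exprn_ge0// ltW.
- apply: eq_integrable (integrableD _ IHp IHq) => // x _.
  by rewrite hornerD mulrDl EFinD.
- apply: eq_integrable (integrableZl _ a IH) => // x _.
  by rewrite hornerZ -mulrA EFinM.
Qed.

Lemma laguerre_functional_is_scalar (R : realType) :
  scalar (@laguerre_functional R).
Proof.
move=> a p q; rewrite /laguerre_functional.
under eq_Rintegral do rewrite hornerD hornerZ mulrDl -mulrA.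
rewrite RintegralD//; last first.
- exact: integrable_horner_expRN.
- exact: (integrableZl _ a (integrable_horner_expRN p)).
by rewrite RintegralZl//; exact: integrable_horner_expRN.
Qed.

HB.instance Definition _ (R : realType) :=
  GRing.isLinear.Build R {poly R} R *%R (@laguerre_functional R)
    (@laguerre_functional_is_scalar R).

Lemma laguerre_dirac_functional_is_scalar (R : realType) (M : R) :
  scalar (laguerre_dirac_functional M).
Proof.
by move=> a p q; rewrite /laguerre_dirac_functional linearP/= hornerD hornerZ; ring.
Qed.

HB.instance Definition _ (R : realType) (M : R) :=
  GRing.isLinear.Build R {poly R} R *%R (laguerre_dirac_functional M)
    (laguerre_dirac_functional_is_scalar M).

(** Discharges the hypothesis of [LaguerreFunctional]; on X^(n+1) it is (n+1)! - (n+1) n! = 0. *)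
Lemma laguerre_functional_subr_deriv (R : realType) (p : {poly R}) :
  laguerre_functional (p - p^`()) = p.[0].
Proof.
have cX n : laguerre_functional ('X^n : {poly R}) = n`!%:R.
  by rewrite /laguerre_functional /Rintegral integral_Xn_expRN.
elim/poly_ind_Xn: p => [[|n]|p q IHp IHq|a p IH].
- by rewrite expr0 derivC subr0 hornerC -(expr0 'X) cX.
- by rewrite derivXn linearB linearMn/= !cX hornerXn expr0n/= factS natrM mulr_natl subrr.
- by rewrite derivD opprD addrACA linearD/= hornerD -IHp -IHq.
- by rewrite derivZ -scalerBr linearZ/= IH hornerZ.
Qed.

(** * Adding a mass at the origin *)

Lemma laguerre_monic_orthogonal (R : realType) :
  monic_orthogonal (@laguerre_functional R) (laguerre R).
Proof.
apply: monic_orthogonal_of_lower => [n|n|n q sq].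
- exact: size_laguerre.
- exact: laguerre_monic.
- by apply: laguerre_orthogonal => //; exact: laguerre_functional_subr_deriv.
Qed.

(** For deg q < n, pairing L_n + t L_n' with q gives L_n(0) q(0) (-t + M (1 - n t)), which vanishes
    for t = M / (nM + 1). *)
Definition laguerre_dirac (R : realType) (M : R) (n : nat) : {poly R} :=
  laguerre R n + (M / (n%:R * M + 1)) *: (laguerre R n)^`().

Lemma deriv_laguerre_dirac (R : realType) (M : R) (n : nat) :
  (laguerre_dirac M n)^`() =
    (laguerre R n)^`() + (M / (n%:R * M + 1)) *: ((laguerre R n)^`())^`().
Proof. by rewrite derivD derivZ. Qed.

Lemma natrMD1_neq0 (R : realType) (M : R) (n : nat) : 0 <= M ->
  n%:R * M + 1 != 0.
Proof. by move=> M0; rewrite gt_eqF// ltr_wpDl// mulr_ge0. Qed.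

Section LaguerreDirac.
Variables (R : realType) (M : R).
Hypothesis M_ge0 : 0 <= M.

Let cD := @laguerre_functional_subr_deriv R.

Lemma laguerre_dirac_at0 (n : nat) :
  (laguerre_dirac M n).[0] = (laguerre R n).[0] / (n%:R * M + 1).
Proof.
rewrite hornerD hornerZ (deriv_laguerre_at0 (c := @laguerre_functional R) cD).
by have := natrMD1_neq0 n M_ge0 => ?; field.
Qed.

Lemma size_laguerre_dirac (n : nat) : size (laguerre_dirac M n) = n.+1.
Proof.
rewrite size_polyDl size_laguerre// ltnS.
exact: leq_trans (size_scale_leq _ _) (size_deriv_laguerre _ _).
Qed.

Lemma laguerre_dirac_monic (n : nat) : laguerre_dirac M n \is monic.
Proof.
rewrite monicE lead_coefDl -?monicE ?laguerre_monic// size_laguerre ltnS.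
exact: leq_trans (size_scale_leq _ _) (size_deriv_laguerre _ _).
Qed.

Lemma laguerre_dirac_lower (n : nat) (q : {poly R}) : (size q <= n)%N ->
  laguerre_dirac_functional M (laguerre_dirac M n * q) = 0.
Proof.
move=> qn; rewrite /laguerre_dirac_functional hornerM laguerre_dirac_at0.
rewrite mulrDl linearD/= (laguerre_orthogonal (c := @laguerre_functional R) cD)//.
rewrite -scalerAl linearZ/=.
rewrite (deriv_laguerre_reproducing (c := @laguerre_functional R) cD)//.
by ring.
Qed.

Lemma laguerre_dirac_monic_orthogonal :
  monic_orthogonal (laguerre_dirac_functional M) (laguerre_dirac M).
Proof.
apply: monic_orthogonal_of_lower => [n|n|n q sq].
- exact: size_laguerre_dirac.
- exact: laguerre_dirac_monic.
- exact: laguerre_dirac_lower.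
Qed.

(** Orthogonality reduces c_0(P_n^2) to c_0(P_n L_n): the weight contributes n!^2, as L_n' is
    orthogonal to L_n, and the mass contributes M n!^2 / (nM + 1). *)
Lemma laguerre_dirac_norm (n : nat) :
  laguerre_dirac_functional M (laguerre_dirac M n ^+ 2) =
    n`!%:R ^+ 2 * (((n + 1)%:R * M + 1) / (n%:R * M + 1)).
Proof.
rewrite expr2 {2}/laguerre_dirac mulrDr linearD/=.
rewrite [X in _ + X]laguerre_dirac_lower; last first.
  exact: leq_trans (size_scale_leq _ _) (size_deriv_laguerre _ _).
rewrite addr0 /laguerre_dirac_functional hornerM laguerre_dirac_at0.
rewrite mulrDl linearD/= -expr2.
rewrite (laguerre_norm (c := @laguerre_functional R) cD).
rewrite -scalerAl [_^`() * _]mulrC linearZ/=.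
rewrite (laguerre_orthogonal (c := @laguerre_functional R) cD) ?size_deriv_laguerre//.
rewrite (laguerre_at0 (c := @laguerre_functional R) cD) natrD.
have := natrMD1_neq0 n M_ge0 => d0.
have sq : ((-1) ^+ n) ^+ 2 = 1 :> R by rewrite sqrr_sign.
have -> : (-1) ^+ n * n`!%:R / (n%:R * M + 1) * ((-1) ^+ n * n`!%:R) =
  ((-1) ^+ n) ^+ 2 * (n`!%:R ^+ 2 / (n%:R * M + 1)) :> R by ring.
by rewrite sq; field.
Qed.

Lemma coherence_laguerre_dirac (n : nat) (s : R) : (1 <= n)%N ->
  coherence_coefficient (laguerre_dirac M) (laguerre R) n s <->
    s = - (n%:R * (1 + n%:R * M) / ((n + 1)%:R * M + 1)).
Proof.
move=> n_gt0.
have n0 : n%:R != 0 :> R by rewrite pnatr_eq0 -lt0n.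
have d0 := natrMD1_neq0 n M_ge0; have d1 := natrMD1_neq0 n.+1 M_ge0.
have n1 : n.+1%:R != 0 :> R by rewrite pnatr_eq0.
set r := - _.
have rE : laguerre R n = n.+1%:R^-1 *: (laguerre_dirac M n.+1)^`()
    - r *: (n%:R^-1 *: (laguerre_dirac M n)^`()).
  rewrite !deriv_laguerre_dirac !deriv_laguerreS derivMn derivB.
  rewrite -nat1r in d1.
  set u := laguerre R n; set v := u^`(); set w := v^`().
  set m1 := M / _; set m0 := M / _.
  (* With P_(n+1)'/(n+1) = u - v + m1 (v - w) and P_n' = v + m0 w, the coefficients of v and w
     impose two conditions on r, and both hold. *)
  have r_m1 : r / n%:R = m1 - 1.
    by rewrite /r /m1 natrD -nat1r; field; rewrite d1 n0.
  have r_m0 : r / n%:R * m0 = - m1.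
    by rewrite /r /m0 /m1 natrD -nat1r; field; rewrite d0 d1 n0.
  rewrite -scalerMnr -mulrnDl -(scaler_nat n.+1 (_ + _)) scalerA mulVf// scale1r.
  rewrite scalerA [_ *: (v + m0 *: w)]scalerDr scalerA r_m0 r_m1.
  by rewrite -!mul_polyC polyCN polyCB; ring.
split=> [|->]; last exact: rE.
rewrite /coherence_coefficient {1}rE => /addrI/oppr_inj/eqP.
rewrite -subr_eq0 -scalerBl scaler_eq0 subr_eq0 => /orP[/eqP//|].
rewrite scaler_eq0 invr_eq0 (negbTE n0)/=.
(* Uniqueness: P_n' is nonzero, since its coefficient of degree n-1 is n. *)
move=> /eqP/(congr1 (fun p : {poly R} => p`_n.-1)).
have /monicP := laguerre_dirac_monic n; rewrite lead_coefE size_laguerre_dirac.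
by rewrite coef_deriv prednK// coef0 => -> /eqP; rewrite (negbTE n0).
Qed.

End LaguerreDirac.

Theorem mainTheorem5 (R : realType) (M : R) (L P : nat -> {poly R})
    (hM : 0 <= M)
    (hL : monic_orthogonal (@laguerre_functional R) L)
    (hP : monic_orthogonal (laguerre_dirac_functional M) P) :
  [/\ forall n : nat,
        P n = L n + \sum_(j < n)
          ((-1) ^+ (n + 1 + j) *
             (n`!%:R * M / (j`!%:R * (n%:R * M + 1)))) *: L j,
      forall n : nat,
        laguerre_dirac_functional M (P n ^+ 2) =
          n`!%:R ^+ 2 * (((n + 1)%:R * M + 1) / (n%:R * M + 1))
    & forall (n : nat) (s : R), (1 <= n)%N ->
        coherence_coefficient P L n s <->
          s = - (n%:R * (1 + n%:R * M) / ((n + 1)%:R * M + 1))].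
Proof.
have -> : L = laguerre R.
  apply/funext => n; apply: monic_orthogonal_uniq hL (@laguerre_monic_orthogonal R) _.
  move=> k; rewrite (laguerre_norm (c := @laguerre_functional R)).
    by rewrite expf_neq0// pnatr_eq0 -lt0n fact_gt0.
  exact: laguerre_functional_subr_deriv.
have -> : P = laguerre_dirac M.
  apply/funext => n.
  apply: monic_orthogonal_uniq hP (laguerre_dirac_monic_orthogonal hM) _ => k.
  by rewrite /= laguerre_dirac_norm// !mulf_neq0 ?invr_eq0 ?natrMD1_neq0//.
split=> [n|n|n s n_gt0].
- rewrite /laguerre_dirac sum_deriv_laguerre scaler_sumr; congr (_ + _).
  apply: eq_bigr => j _; rewrite scalerA; congr (_ *: _).
  have := natrMD1_neq0 n hM => d0.
  have j0 : j`!%:R != 0 :> R by rewrite pnatr_eq0 -lt0n fact_gt0.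
  by field; rewrite d0.
- exact: laguerre_dirac_norm.
- exact: coherence_laguerre_dirac.
Qed.
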